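(* Let $g:\mathbb{R}^n\to(-\infty,+\infty]$ be a proper closed convex and symmetric function, and let $\theta:\mathbb{S}^n\to(-\infty,+\infty]$ be the spectral function $\theta(X)=g(\lambda(X))$, $X\in\mathbb{S}^n$. Let $(\overline{X},\overline{W})\in\mathrm{gph}\,\partial\theta$. If the subdifferential mapping $\partial g$ is metrically subregular at $\lambda(\overline{X})$ for $\lambda(\overline{W})$, then the subdifferential mapping $\partial\theta$ is metrically subregular at $\overline{X}$ for $\overline{W}$.
   Context: $\mathbb{S}^n$ is the space of real symmetric $n\times n$ matrices with the trace inner product and the Frobenius norm. $\lambda(X)\in\mathbb{R}^n$ is the vector of eigenvalues of $X\in\mathbb{S}^n$ in non-increasing order. $g$ is symmetric if $g(x)=g(Qx)$ for every $x\in\mathbb{R}^n$ and every permutation matrix $Q$. $\partial$ is the subdifferential of convex analysis. Metric subregularity: for a set-valued mapping $G:\mathbb{U}\rightrightarrows\mathbb{V}$ between finite dimensional Euclidean spaces, with $\mathrm{gph}\,G=\{(u,v)\mid v\in G(u)\}$ and $G^{-1}(v)=\{u\mid v\in G(u)\}$, $G$ is metrically subregular at $\bar u$ for $\bar v$ if $(\bar u,\bar v)\in\mathrm{gph}\,G$ and there exist $\delta>0$, $\varepsilon>0$, $\kappa>0$ such that $\mathrm{dist}(u,G^{-1}(\bar v))\le\kappa\,\mathrm{dist}(\bar v,G(u)\cap\mathbb{B}_\delta(\bar v))$ for all $u\in\mathbb{B}_\varepsilon(\bar u)$, where $\mathbb{B}_\rho(u)$ is the closed ball of radius $\rho$ centered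 at $u$, and the distance to the empty set is $+\infty$. *)

(* Defs.v *)
From HB Require Import structures.
From mathcomp Require Import all_boot all_order all_fingroup all_algebra.
From mathcomp Require Import all_classical all_reals all_analysis.
From mathcomp Require Import complex.

Set Implicit Arguments.
Unset Strict Implicit.
Unset Printing Implicit Defensive.

Import Order.TTheory GRing.Theory Num.Theory.
Local Open Scope classical_set_scope.
Local Open Scope ring_scope.

Section EuclideanSpace.
Context {R : realType} {V : lmodType R}.
Variable dot : {dot V for (@idfun R)}.

(* The norm induced by the inner product: the norm that the library puts on
   matrices is the sup norm. *)
Definition dnorm (u : V) : R := Num.sqrt (dot u u).

Definition cball (x : V) (r : R) : set V := [set y | dnorm (y - x) <= r].

(* Extended-real-valued, with value +oo on the empty set ([ereal_inf0]). *)
Definition dist_set (x : V) (A : set V) : \bar R :=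
  ereal_inf [set (dnorm (x - y))%:E | y in A].

Definition subdiff (f : V -> \bar R) (x : V) : set V :=
  [set v | forall y, (f x + (dot v (y - x))%:E <= f y)%E].

End EuclideanSpace.

Section SetValued.
Context {U V : Type}.
Implicit Type G : U -> set V.

Definition gph G : set (U * V) := [set p | G p.1 p.2].

Definition inv_map G (v : V) : set U := [set u | G u v].

End SetValued.

Definition metrically_subregular (R : realType) (U V : lmodType R)
    (dotU : {dot U for (@idfun R)}) (dotV : {dot V for (@idfun R)})
    (G : U -> set V) (ubar : U) (vbar : V) : Prop :=
  gph G (ubar, vbar) /\
  exists delta eps kappa : R, [/\ 0 < delta, 0 < eps, 0 < kappa &
    forall u, cball dotU ubar eps u ->
      (dist_set dotU u (inv_map G vbar) <=
       kappa%:E * dist_set dotV vbar (G u `&` cball dotV vbar delta))%E].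

Section ExtendedFunctions.
Context {R : realType}.

Definition proper_fun (V : Type) (f : V -> \bar R) : Prop :=
  (forall x, f x != -oo%E) /\ (exists x, f x != +oo%E).

(* Meant for functions that do not take the value -oo, so that the right-hand
   side is never of the form +oo - oo; recall that 0 * +oo = 0. *)
Definition econvex_fun (V : lmodType R) (f : V -> \bar R) : Prop :=
  forall (x y : V) (t : R), 0 <= t <= 1 ->
    (f (t *: x + (1 - t) *: y)%R <= t%:E * f x + (1 - t)%:E * f y)%E.

(* Elements of R^n are row vectors, so permutation matrices act on the right. *)
Definition perm_invariant (n : nat) (g : 'rV[R]_n -> \bar R) : Prop :=
  forall (Q : 'M[R]_n) (x : 'rV[R]_n), is_perm_mx Q -> g x = g (x *m Q).

End ExtendedFunctions.

Section DotRow.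
Context {R : realType} {n : nat}.

Definition rvdot (u v : 'rV[R]_n) : R := \sum_i u 0 i * v 0 i.

Let rvdot_linear_r u : linear_for *%R (rvdot u).
Proof.
move=> a v w; rewrite /rvdot mulr_sumr -big_split /=; apply: eq_bigr => i _.
by rewrite !mxE mulrDr mulrCA.
Qed.

Let rvdotC u v : rvdot u v = rvdot v u.
Proof. by apply: eq_bigr => i _; rewrite mulrC. Qed.

Let rvdot_linear_l v : linear_for *%R (rvdot^~ v).
Proof. by move=> a u w; rewrite /= ![rvdot _ v]rvdotC rvdot_linear_r. Qed.

Let rvdot_herm u v : rvdot u v = (-1) ^+ false * idfun (rvdot v u).
Proof. by rewrite expr0 mul1r /= rvdotC. Qed.

Let rvdot_gt0 u : u != 0 -> 0 < rvdot u u.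
Proof.
move=> u0; rewrite lt_def sumr_ge0 ?andbT; last first.
  by move=> i _; rewrite -expr2 sqr_ge0.
apply: contra u0; rewrite psumr_eq0; last first.
  by move=> i _; rewrite -expr2 sqr_ge0.
move=> /allP u0; apply/eqP/rowP => i; rewrite mxE; apply/eqP.
by have := u0 i (mem_index_enum i); rewrite mulf_eq0 orbb.
Qed.

HB.instance Definition _ := @bilinear_isBilinear.Build R _ _ _ *%R
  ( *%R : R -> R -> R) rvdot (pair rvdot_linear_l rvdot_linear_r).
HB.instance Definition _ :=
  @isHermitianSesquilinear.Build _ _ _ _ rvdot rvdot_herm.
HB.instance Definition _ := @isDotProduct.Build _ _ rvdot rvdot_gt0.

End DotRow.

Lemma symmetricmxE (F : fieldType) (n : nat) (A : 'M[F]_n) :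
  (A \is symmetricmx) = (A^T == A).
Proof.
by rewrite is_hermitianmxE expr0 scale1r (map_mx_id (fun=> erefl)) eq_sym.
Qed.

Section SymmetricMatrices.
Context {R : realType} {n : nat}.

Fact symmetricmx_submod : submod_closed (symmetricmx : {pred 'M[R]_n}).
Proof.
split=> [|a A B]; rewrite !symmetricmxE ?trmx0// => /eqP AT /eqP BT.
by rewrite linearP /= AT BT.
Qed.

HB.instance Definition _ := GRing.isSubmodClosed.Build R 'M[R]_n
  (symmetricmx : {pred 'M[R]_n}) symmetricmx_submod.

End SymmetricMatrices.

Record symmx (R : realType) (n : nat) := SymMx {
  symmx_val :> 'M[R]_n;
  symmxP : symmx_val \is symmetricmx
}.

Section SymmxTheory.
Context {R : realType} {n : nat}.

HB.instance Definition _ := [isSub for @symmx_val R n].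
HB.instance Definition _ := [Choice of symmx R n by <:].
HB.instance Definition _ := [SubChoice_isSubLmodule of symmx R n by <:].

Definition symdot (A B : symmx R n) : R := \tr (val A *m val B).

Let symdot_linear_r A : linear_for *%R (symdot A).
Proof.
move=> a B C; rewrite /symdot [val (_ + _)]linearP mulmxDr -scalemxAr.
by rewrite mxtraceD mxtraceZ.
Qed.

Let symdotC A B : symdot A B = symdot B A.
Proof. by rewrite /symdot mxtrace_mulC. Qed.

Let symdot_linear_l B : linear_for *%R (symdot^~ B).
Proof. by move=> a A C; rewrite /= ![symdot _ B]symdotC symdot_linear_r. Qed.

Let symdot_herm A B : symdot A B = (-1) ^+ false * idfun (symdot B A).
Proof. by rewrite expr0 mul1r /= symdotC. Qed.

Let symdot_gt0 A : A != 0 -> 0 < symdot A A.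
Proof.
have symdotE : symdot A A = \sum_i \sum_j (val A i j) ^+ 2.
  have /eqP AT : (val A)^T == val A by rewrite -symmetricmxE; exact: symmxP.
  rewrite /symdot -{2}AT /mxtrace; apply: eq_bigr => i _.
  by rewrite mxE; apply: eq_bigr => j _; rewrite mxE expr2.
move=> A0; rewrite symdotE lt_def sumr_ge0 ?andbT; last first.
  by move=> i _; rewrite sumr_ge0// => j _; rewrite sqr_ge0.
apply: contra A0; rewrite psumr_eq0; last first.
  by move=> i _; rewrite sumr_ge0// => j _; rewrite sqr_ge0.
move=> /allP A0; apply/eqP/val_inj/matrixP => i j; rewrite raddf0 mxE.
have := A0 i (mem_index_enum i); rewrite psumr_eq0; last first.
  by move=> k _; rewrite sqr_ge0.
by move=> /allP/(_ j (mem_index_enum j)); rewrite sqrf_eq0 => /eqP.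
Qed.

HB.instance Definition _ := @bilinear_isBilinear.Build R _ _ _ *%R
  ( *%R : R -> R -> R) symdot (pair symdot_linear_l symdot_linear_r).
HB.instance Definition _ :=
  @isHermitianSesquilinear.Build _ _ _ _ symdot symdot_herm.
HB.instance Definition _ := @isDotProduct.Build _ _ symdot symdot_gt0.

End SymmxTheory.

Section Eigenvalues.
Context {R : realType} {n : nat}.

Definition nonincreasing_rv (l : 'rV[R]_n) : Prop :=
  forall i j : 'I_n, (i <= j)%N -> l 0 j <= l 0 i.

(* [l] lists the eigenvalues of [A], each repeated according to its
   multiplicity, in non-increasing order. *)
Definition is_eigvals (A : 'M[R]_n) (l : 'rV[R]_n) : Prop :=
  nonincreasing_rv l /\ char_poly A = \prod_(i < n) ('X - (l 0 i)%:P).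

(* The unique such vector: see [eigvalsP] and [is_eigvals_unique]. *)
Definition eigvals (X : symmx R n) : 'rV[R]_n :=
  xget 0 [set l | is_eigvals (symmx_val X) l].

Lemma is_eigvals_unique (A : 'M[R]_n) (l m : 'rV[R]_n) :
  is_eigvals A l -> is_eigvals A m -> l = m.
Proof.
pose s (u : 'rV[R]_n) := [seq u 0 i | i <- enum 'I_n].
have ge_trans : transitive (>=%R : rel R).
  by move=> y x z yx zy; exact: le_trans zy yx.
have ge_anti : antisymmetric (>=%R : rel R).
  by move=> x y; rewrite andbC => /le_anti.
have sP u : nonincreasing_rv u -> sorted >=%R (s u).
  move=> uP; rewrite sorted_map.
  have : sorted (relpre val leq) (enum 'I_n).
    by rewrite -sorted_map val_enum_ord iota_sorted.
  by apply: sub_sorted => i j /= /uP.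
have prodE (u : 'rV[R]_n) : \prod_(i < n) ('X - (u 0 i)%:P) = \prod_(c <- s u) ('X - c%:P).
  by rewrite big_map big_enum.
move=> [/sP lP lA] [/sP mP mA].
have slm : s l = s m.
  apply: (sorted_eq ge_trans ge_anti lP mP).
  by apply: prod_XsubC_eq; rewrite -!prodE -lA.
apply/rowP => i; have := congr1 (fun t => nth 0 t (i : nat)) slm.
by rewrite !(nth_map i) -?enumT ?size_enum_ord// nth_ord_enum.
Qed.

Lemma char_poly_conjmx (F : fieldType) (P D : 'M[F]_n) : P \in unitmx ->
  char_poly (invmx P *m D *m P) = char_poly D.
Proof.
move=> Pu; have PVP : map_mx polyC (invmx P) *m map_mx polyC P = 1%:M.
  by rewrite -map_mxM mulVmx// map_mx1.
rewrite /char_poly; have -> : char_poly_mx (invmx P *m D *m P) =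
    map_mx polyC (invmx P) *m char_poly_mx D *m map_mx polyC P.
  rewrite /char_poly_mx mulmxBr mulmxBl scalar_mxC -(mulmxA 'X%:M).
  by rewrite PVP mulmx1 -!map_mxM.
by rewrite !det_mulmx mulrAC -det_mulmx PVP det1 mul1r.
Qed.

Lemma is_eigvals_exists (A : 'M[R]_n) : A \is symmetricmx ->
  exists l, is_eigvals A l.
Proof.
move=> Asym; pose AC := map_mx (real_complex R) A.
have ACreal : AC \is a mxOver Num.real.
  by apply/mxOverP => i j; rewrite mxE complex_real.
have ACsym : AC \is symmetricmx.
  by move: Asym; rewrite !symmetricmxE map_trmx => /eqP ->.
have ACherm : AC \is hermsymmx by exact: realsym_hermsym.
have /orthomx_spectralP ACE := hermitian_normalmx ACherm.
have /mxOverP Dreal := hermitian_spectral_diag_real ACherm.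
pose d i := complex.Re (spectral_diag AC 0 i).
have AE : char_poly A = \prod_(c <- codom d) ('X - c%:P).
  apply: (map_poly_inj (real_complex R)).
  rewrite map_char_poly -/AC ACE char_poly_conjmx ?spectral_unit//.
  rewrite char_poly_trig ?diag_mx_is_trig// rmorph_prod big_map enumT.
  apply: eq_bigr => i _; rewrite rmorphB /= map_polyX map_polyC /= mxE eqxx.
  by rewrite mulr1n /d RRe_real.
pose t := sort >=%R (codom d).
have size_t : size t = n by rewrite size_sort size_codom card_ord.
have t_sorted : sorted >=%R t by apply: sort_sorted => x y; exact: le_total.
have ge_trans : transitive (>=%R : rel R).
  by move=> y x z yx zy; exact: le_trans zy yx.
exists (\row_i nth 0 t i); split=> [i j ij|].
  rewrite !mxE; apply: (sorted_leq_nth ge_trans _ _ t_sorted);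
    rewrite ?inE ?size_t//.
  by move=> x; exact: lexx.
rewrite AE -(perm_big _ (permEl (perm_sort >=%R (codom d)))) /= -/t.
rewrite (big_nth 0) size_t big_mkord; apply: eq_bigr => i _.
by rewrite mxE.
Qed.

Lemma eigvalsP (X : symmx R n) : is_eigvals X (eigvals X).
Proof.
have [l lP] := is_eigvals_exists (symmxP X).
exact: (@xgetPex _ 0 [set l | is_eigvals X l] (ex_intro _ l lP)).
Qed.

End Eigenvalues.

Definition spectral_fun (R : realType) (n : nat) (g : 'rV[R]_n -> \bar R)
  : symmx R n -> \bar R := fun X => g (eigvals X).

(* Main.v *)
Require Import Defs.
From mathcomp Require Import all_boot all_order all_algebra.
From mathcomp Require Import fingroup perm ring lra.
From mathcomp Require Import all_classical all_reals all_analysis.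

(** Write X = P diag(x) P^T with x the sorted eigenvalues of X.  The proof pulls
a pair (X, W) of the graph of the subdifferential of the spectral function back
to the pair (x, w) of eigenvalue vectors, applies metric subregularity of the
subdifferential of g there, and rebuilds a matrix from the resulting vector.

Everything rests on Fan's inequality tr(X W) <= <x, w> ([fan_inequality]) and
its equality case ([fan_equality]): equality forces X and W to be diagonalized
by the same orthogonal matrix, with both spectra sorted.

- Pulling back.  If W is a subgradient at X, comparing X with a matrix that has
  the eigenvalues of X and the eigenvectors of W shows that Fan's inequality is
  tight ([subdiff_spectral_fan_eq]).  Hence w is a subgradient of g at x
  ([subdiff_eigvals]), and X = P diag(x) P^T, W = P diag(w) P^T for a common P.
  Since eigenvalues are nonexpansive ([eigvals_nonexpansive]), x is close to the
  eigenvalues of Xbar and |w - wbar| <= |W - Wbar|.  Subregularity of the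
  subdifferential of g gives x' with wbar a subgradient of g at x' and |x - x'|
  bounded by a multiple of |W - Wbar|.

- Rebuilding.  For any orthogonal Q with Wbar = Q diag(wbar) Q^T, Fan's
  inequality makes Wbar a subgradient at Q diag(x') Q^T ([subdiff_sym_diag]).
  It remains to choose Q so that this matrix is close to X = P diag(x) P^T, for
  which |P - Q| <= K |W - Wbar| is enough.  Such a Q exists because the frame P
  diagonalizes a matrix close to Wbar ([eigenbasis_perturbation]): in an
  eigenbasis Q0 of Wbar, the entries of Q0^T P that mix distinct eigenvalues of
  Wbar are at most a multiple of |W - Wbar| over the spectral gap; setting them
  to zero gives a matrix that commutes with diag(wbar) and is almost orthogonal,
  and its orthogonal polar factor still commutes with diag(wbar).

Then |X - Q diag(x') Q^T| <= 2 |P - Q| |x| + |x - x'|, where |x| = |X| is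
bounded near Xbar. *)

Set Implicit Arguments.
Unset Strict Implicit.
Unset Printing Implicit Defensive.

Import Order.TTheory GRing.Theory Num.Theory.
Import numFieldNormedType.Exports.
Local Open Scope classical_set_scope.
Local Open Scope ring_scope.

(** * Norms of real inner products *)

Section DotNorm.
Context {R : realType} {V : lmodType R}.
Variable dot : {dot V for (@idfun R)}.
Implicit Types u v : V.

Lemma dotC u v : dot u v = dot v u.
Proof. by rewrite hermC expr0 mul1r. Qed.

Lemma dot_gt0 u : u != 0 -> 0 < dot u u.
Proof. exact: neq0_dnorm_gt0. Qed.

Lemma dot_ge0 u : 0 <= dot u u.
Proof.
have [->|u0] := eqVneq u 0; first by rewrite linear0l.
exact: ltW (dot_gt0 u0).
Qed.

Lemma dot_le0_eq0 u : dot u u <= 0 -> u = 0.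
Proof.
move=> u0; apply/eqP; apply: contraTT u0 => /dot_gt0.
by rewrite -ltNge.
Qed.

Lemma sqr_dnorm u : dnorm dot u ^+ 2 = dot u u.
Proof. by rewrite sqr_sqrtr// dot_ge0. Qed.

Lemma dnorm_nneg u : 0 <= dnorm dot u.
Proof. exact: sqrtr_ge0. Qed.

Lemma dnorm_opp u : dnorm dot (- u) = dnorm dot u.
Proof. by rewrite /dnorm linearNl linearNr opprK. Qed.

Lemma dnorm_subC u v : dnorm dot (u - v) = dnorm dot (v - u).
Proof. by rewrite -dnorm_opp opprB. Qed.

Lemma dotBB u v : dot (u - v) (u - v) = dot u u - 2 * dot u v + dot v v.
Proof. by rewrite linearBl !linearBr /= [dot v u]dotC; ring. Qed.

Lemma dotDD u v : dot (u + v) (u + v) = dot u u + 2 * dot u v + dot v v.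
Proof. by rewrite linearDl !linearDr /= [dot v u]dotC; ring. Qed.

Lemma cauchy_schwarz u v : dot u v <= dnorm dot u * dnorm dot v.
Proof.
have [v0|v0] := eqVneq v 0.
  by rewrite v0 linear0r mulr_ge0 ?dnorm_nneg.
have vv : 0 < dot v v := dot_gt0 v0.
have [uv|uv] := leP (dot u v) 0.
  by rewrite (le_trans uv)// mulr_ge0 ?dnorm_nneg.
rewrite -(@ler_pXn2r _ 2) ?nnegrE ?mulr_ge0 ?dnorm_nneg ?(ltW uv)//.
rewrite exprMn !sqr_dnorm.
(* The component of [u] orthogonal to [v], scaled by [dot v v]. *)
have := dot_ge0 (dot v v *: u - dot u v *: v).
rewrite dotBB !linearZl_LR !linearZr_LR /= /GRing.scale /= => h.
rewrite -subr_ge0 -(pmulr_rge0 _ vv); apply: le_trans h _.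
by rewrite le_eqVlt; apply/orP; left; apply/eqP; ring.
Qed.

Lemma dnorm_triangle u v : dnorm dot (u + v) <= dnorm dot u + dnorm dot v.
Proof.
rewrite -(@ler_pXn2r _ 2) ?nnegrE ?addr_ge0 ?dnorm_nneg//.
rewrite sqrrD !sqr_dnorm dotDD.
by have := cauchy_schwarz u v; lra.
Qed.

End DotNorm.

(** * The Frobenius norm *)

Section Frobenius.
Context {R : realType}.

(** The norm of [symdot] only covers symmetric matrices, whereas the difference
P - Q of two eigenbases has to be measured too. *)
Definition frob m n (A : 'M[R]_(m, n)) : R := dnorm rvdot (mxvec A).

Lemma frob_ge0 m n (A : 'M[R]_(m, n)) : 0 <= frob A.
Proof. exact: dnorm_nneg. Qed.

Lemma sqr_frob m n (A : 'M[R]_(m, n)) :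
  frob A ^+ 2 = \sum_i \sum_j A i j ^+ 2.
Proof.
rewrite /frob sqr_dnorm /= /rvdot pair_bigA /=.
rewrite (reindex _ (curry_mxvec_bij _ _)) /=.
by apply: eq_bigr => -[i j] _ /=; rewrite mxvecE expr2.
Qed.

Lemma sqr_frob_tr m n (A : 'M[R]_(m, n)) : frob A ^+ 2 = \tr (A^T *m A).
Proof.
rewrite sqr_frob exchange_big; apply: eq_bigr => j _.
by rewrite mxE; apply: eq_bigr => i _; rewrite mxE expr2.
Qed.

Lemma eq_frob m n p q (A : 'M[R]_(m, n)) (B : 'M[R]_(p, q)) :
  frob A ^+ 2 = frob B ^+ 2 -> frob A = frob B.
Proof. by move/eqP; rewrite eqrXn2 ?frob_ge0// => /eqP. Qed.

Lemma frob_tr m n (A : 'M[R]_(m, n)) : frob A^T = frob A.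
Proof.
apply: eq_frob; rewrite !sqr_frob exchange_big.
by apply: eq_bigr => i _; apply: eq_bigr => j _; rewrite mxE.
Qed.

Lemma frobN m n (A : 'M[R]_(m, n)) : frob (- A) = frob A.
Proof. by rewrite /frob linearN dnorm_opp. Qed.

Lemma frobD m n (A B : 'M[R]_(m, n)) : frob (A + B) <= frob A + frob B.
Proof. by rewrite /frob linearD /=; exact: dnorm_triangle. Qed.

Lemma le_frob m n (A B : 'M[R]_(m, n)) c : 0 <= c ->
  (forall i j, `|A i j| <= c * `|B i j|) -> frob A <= c * frob B.
Proof.
move=> c0 AB; rewrite -(@ler_pXn2r _ 2) ?nnegrE ?mulr_ge0 ?frob_ge0//.
rewrite exprMn !sqr_frob mulr_sumr ler_sum// => i _.
rewrite mulr_sumr ler_sum// => j _.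
rewrite -(real_normK (num_real (A i j))) -(real_normK (num_real (B i j))).
by rewrite -exprMn ler_pXn2r ?nnegrE ?mulr_ge0.
Qed.

Lemma abs_le_frob m n (A : 'M[R]_(m, n)) i j : `|A i j| <= frob A.
Proof.
rewrite -(@ler_pXn2r _ 2) ?nnegrE ?frob_ge0// real_normK ?num_real//.
rewrite sqr_frob (bigD1 i)//= (bigD1 j)//= -addrA lerDl addr_ge0//.
  by apply: sumr_ge0 => k _; exact: sqr_ge0.
by apply: sumr_ge0 => k _; apply: sumr_ge0 => l _; exact: sqr_ge0.
Qed.

(** Cauchy-Schwarz applied to every entry of the product. *)
Lemma frobM m n p (A : 'M[R]_(m, n)) (B : 'M[R]_(n, p)) :
  frob (A *m B) <= frob A * frob B.
Proof.
rewrite -(@ler_pXn2r _ 2) ?nnegrE ?mulr_ge0 ?frob_ge0// exprMn.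
rewrite [frob (_ *m _) ^+ 2]sqr_frob sqr_frob -(frob_tr B) sqr_frob mulr_suml.
apply: ler_sum => i _; rewrite mulr_sumr; apply: ler_sum => j _.
have dotE : (A *m B) i j = rvdot (row i A) (row j B^T).
  by rewrite mxE; apply: eq_bigr => k _; rewrite !mxE.
have sqrE q (u : 'rV[R]_q) : \sum_k u 0 k ^+ 2 = dnorm rvdot u ^+ 2.
  by rewrite sqr_dnorm; apply: eq_bigr => k _; rewrite expr2.
have rowE q r (C : 'M[R]_(q, r)) k :
    \sum_l C k l ^+ 2 = dnorm rvdot (row k C) ^+ 2.
  by rewrite -sqrE; apply: eq_bigr => l _; rewrite mxE.
rewrite dotE !rowE -exprMn -real_normK ?num_real//.
rewrite ler_pXn2r ?nnegrE ?mulr_ge0 ?dnorm_nneg// ler_norml.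
rewrite (cauchy_schwarz rvdot) andbT lerNl -(dnorm_opp rvdot (row i A)).
by apply: le_trans (cauchy_schwarz _ _ _); rewrite linearNl.
Qed.

Lemma frob_orthoL m n p (U : 'M[R]_(m, n)) (A : 'M[R]_(n, p)) :
  U^T *m U = 1%:M -> frob (U *m A) = frob A.
Proof.
move=> UU; apply: eq_frob.
by rewrite !sqr_frob_tr trmx_mul mulmxA -(mulmxA A^T) UU mulmx1.
Qed.

Lemma frob_orthoR m n p (U : 'M[R]_(n, p)) (A : 'M[R]_(m, n)) :
  U *m U^T = 1%:M -> frob (A *m U) = frob A.
Proof.
by move=> UU; rewrite -frob_tr trmx_mul frob_orthoL ?frob_tr// trmxK.
Qed.

Lemma frob_diag n (d : 'rV[R]_n) : frob (diag_mx d) = dnorm rvdot d.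
Proof.
apply/eqP; rewrite -(@eqrXn2 _ 2) ?frob_ge0 ?dnorm_nneg// sqr_frob sqr_dnorm.
apply/eqP; apply: eq_bigr => i _; rewrite (bigD1 i)//= big1 ?addr0.
  by rewrite mxE eqxx mulr1n expr2.
by move=> j ji; rewrite mxE eq_sym (negPf ji) mulr0n expr0n.
Qed.

(** The norm is the square root of [n]; the cruder bound avoids square roots in
the constants below. *)
Lemma frob1 n : frob (1%:M : 'M[R]_n) <= n.+1%:R.
Proof.
rewrite -(@ler_pXn2r _ 2) ?nnegrE ?frob_ge0// sqr_frob_tr trmx1 mulmx1 mxtrace1.
by rewrite -natrX ler_nat (leq_trans (leqnSn n))// leq_pmulr.
Qed.

End Frobenius.

Section DotRowNorm.
Context {R : realType} {n : nat}.
Implicit Types x y : 'rV[R]_n.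

Lemma abs_le_dnorm x i : `|x 0 i| <= dnorm rvdot x.
Proof.
rewrite -frob_diag; apply: le_trans (abs_le_frob _ i i).
by rewrite mxE eqxx mulr1n.
Qed.

Lemma le_dnorm x y :
  (forall i, `|x 0 i| <= `|y 0 i|) -> dnorm rvdot x <= dnorm rvdot y.
Proof.
move=> xy; rewrite -!frob_diag -[leRHS]mul1r; apply: le_frob => // i j.
by rewrite !mxE mul1r; case: eqP => _; rewrite ?mulr1n ?mulr0n.
Qed.

End DotRowNorm.

(** * Orthogonal diagonalization of real symmetric matrices *)

Section Spectral.
Context {R : realType}.

Definition orthogonal_mx n (P : 'M[R]_n) : Prop := P^T *m P = 1%:M.

Lemma orthogonal_mxC n (P : 'M[R]_n) : orthogonal_mx P -> P *m P^T = 1%:M.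
Proof. exact: mulmx1C. Qed.

Lemma orthogonal_trmx n (P : 'M[R]_n) : orthogonal_mx P -> orthogonal_mx P^T.
Proof. by move=> /orthogonal_mxC; rewrite /orthogonal_mx trmxK. Qed.

Lemma orthogonal_mulmx n (P Q : 'M[R]_n) :
  orthogonal_mx P -> orthogonal_mx Q -> orthogonal_mx (P *m Q).
Proof.
rewrite /orthogonal_mx => PP QQ.
by rewrite trmx_mul mulmxA -(mulmxA Q^T) PP mulmx1.
Qed.

Definition conj_diag n (P : 'M[R]_n) (d : 'rV[R]_n) : 'M[R]_n :=
  P *m diag_mx d *m P^T.

Lemma conj_diagE n (P : 'M[R]_n) d i j :
  conj_diag P d i j = \sum_k P i k * d 0 k * P j k.
Proof.
rewrite /conj_diag mxE; apply: eq_bigr => k _.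
by rewrite mul_mx_diag !mxE.
Qed.

Lemma conj_diag_sym n (P : 'M[R]_n) d : (conj_diag P d)^T = conj_diag P d.
Proof. by rewrite /conj_diag !trmx_mul trmxK tr_diag_mx mulmxA. Qed.

Lemma conj_diagM n (V : 'M[R]_n) (a b : 'rV[R]_n) : orthogonal_mx V ->
  conj_diag V a *m conj_diag V b = conj_diag V (\row_i (a 0 i * b 0 i)).
Proof.
move=> VO; rewrite /conj_diag !mulmxA -(mulmxA _ V^T V) VO mulmx1.
by congr (_ *m _); rewrite -!mulmxA mulmx_diag.
Qed.

Lemma conj_diagB n (V : 'M[R]_n) (a b : 'rV[R]_n) :
  conj_diag V (a - b) = conj_diag V a - conj_diag V b.
Proof. by rewrite /conj_diag linearB /= mulmxBr mulmxBl. Qed.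

Lemma conj_diag1 n (V : 'M[R]_n) : orthogonal_mx V ->
  conj_diag V (const_mx 1) = 1%:M.
Proof.
by move=> VO; rewrite /conj_diag diag_const_mx mulmx1 orthogonal_mxC.
Qed.

Lemma frob_conj_diag n (V : 'M[R]_n) (a : 'rV[R]_n) : orthogonal_mx V ->
  frob (conj_diag V a) = dnorm rvdot a.
Proof.
move=> VO; rewrite /conj_diag -frob_diag frob_orthoR ?frob_orthoL//.
by rewrite trmxK.
Qed.

Lemma frob_conj_diag_sub n (P Q : 'M[R]_n) (x : 'rV[R]_n) :
  orthogonal_mx P -> orthogonal_mx Q ->
  frob (conj_diag P x - conj_diag Q x) <= 2 * frob (P - Q) * dnorm rvdot x.
Proof.
move=> PO QO; pose D := diag_mx x.
have -> : conj_diag P x - conj_diag Q x =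
    (P - Q) *m (D *m P^T) + (Q *m D) *m (P - Q)^T.
  rewrite linearB /= mulmxBl mulmxBr /conj_diag -/D !mulmxA.
  by rewrite addrA subrK.
apply: le_trans (frobD _ _) _.
apply: le_trans (lerD (frobM _ _) (frobM _ _)) _.
rewrite frob_tr frob_orthoR ?trmxK// frob_orthoL// frob_diag.
by rewrite -mulrA mulr_natl mulr2n [X in _ + X]mulrC.
Qed.

(** Expressing the difference in the frames [P] and [Q] turns it into a
commutator-like expression, in which the entry (i, j) of Q^T P is multiplied by
x_j - y_i. *)
Lemma frob_conj_diag_sub_frame n (P Q : 'M[R]_n) (x y : 'rV[R]_n) :
  orthogonal_mx P -> orthogonal_mx Q ->
  frob (conj_diag P x - conj_diag Q y) =
  frob (Q^T *m P *m diag_mx x - diag_mx y *m (Q^T *m P)).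
Proof.
move=> PO QO.
have -> : Q^T *m P *m diag_mx x - diag_mx y *m (Q^T *m P) =
    Q^T *m (conj_diag P x - conj_diag Q y) *m P.
  rewrite mulmxBr mulmxBl /conj_diag !mulmxA QO mul1mx.
  by rewrite -(mulmxA _ P^T P) PO mulmx1.
rewrite frob_orthoR; last exact: orthogonal_mxC.
by rewrite frob_orthoL// trmxK; exact: orthogonal_mxC.
Qed.

(** Both sides say that [M], written in the frame [V], vanishes at the entries
(i, j) with s_i different from s_j; applying [f] can only merge values. *)
Lemma comm_conj_diag_map n (M V : 'M[R]_n) (s : 'rV[R]_n) (f : R -> R) :
  orthogonal_mx V -> M *m conj_diag V s = conj_diag V s *m M ->
  M *m conj_diag V (map_mx f s) = conj_diag V (map_mx f s) *m M.
Proof.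
move=> VO; have VV := orthogonal_mxC VO.
pose N := V^T *m M *m V.
have ME : M = V *m N *m V^T.
  by rewrite /N !mulmxA VV mul1mx -mulmxA VV mulmx1.
clearbody N; have conjl d : M *m conj_diag V d = V *m (N *m diag_mx d) *m V^T.
  by rewrite {1}ME /conj_diag !mulmxA -(mulmxA _ V^T V) VO mulmx1.
have conjr d : conj_diag V d *m M = V *m (diag_mx d *m N) *m V^T.
  by rewrite {1}ME /conj_diag !mulmxA -(mulmxA _ V^T V) VO mulmx1.
rewrite !conjl !conjr => /(congr1 (fun A => V^T *m A *m V)) NE.
have {}NE : N *m diag_mx s = diag_mx s *m N.
  by move: NE; rewrite !mulmxA VO !mul1mx -!mulmxA VO !mulmx1.
congr (_ *m _ *m _); apply/matrixP => i j.
have /matrixP/(_ i j) := NE; rewrite !mul_mx_diag !mul_diag_mx !mxE.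
have [->|sij] := eqVneq (s 0 i) (s 0 j); first by move=> _; exact: mulrC.
move=> /eqP; rewrite mulrC -subr_eq0 -mulrBl mulf_eq0 subr_eq0 eq_sym.
by rewrite (negPf sij) /= => /eqP ->; rewrite mulr0 mul0r.
Qed.

Lemma char_poly_conj_diag n (P : 'M[R]_n) (x : 'rV[R]_n) : orthogonal_mx P ->
  char_poly (conj_diag P x) = \prod_(i < n) ('X - (x 0 i)%:P).
Proof.
move=> PO; have Pu : P^T \in unitmx by have [] := mulmx1_unit PO.
have -> : conj_diag P x = invmx P^T *m diag_mx x *m P^T.
  rewrite /conj_diag; congr (_ *m _ *m _).
  by rewrite -[LHS]mul1mx -(mulVmx Pu) -mulmxA PO mulmx1.
rewrite char_poly_conjmx// char_poly_trig ?diag_mx_is_trig//.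
by apply: eq_bigr => i _; rewrite mxE eqxx mulr1n.
Qed.

(** The reflection exchanging [u] and the first basis vector, namely
I - 2 z^T z / |z|^2 with z = u - e_0. *)
Lemma householder_reflection n (u : 'rV[R]_n.+1) : rvdot u u = 1 ->
  exists2 H : 'M[R]_n.+1, H^T = H /\ orthogonal_mx H &
    delta_mx 0 0 *m H = u /\ u *m H = delta_mx 0 0.
Proof.
move=> u1; set e : 'rV[R]_n.+1 := delta_mx 0 0.
have e1 : rvdot e e = 1.
  rewrite /rvdot (bigD1 0)//= big1 => [|i i0]; rewrite !mxE.
    by rewrite mulr1 addr0.
  by rewrite (negPf i0) mulr0.
have dotE (a b : 'rV[R]_n.+1) : a *m b^T = (rvdot a b)%:M.
  apply/matrixP => i j; rewrite !ord1 !mxE eqxx mulr1n.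
  by apply: eq_bigr => k _; rewrite !mxE.
have [ue|ue] := eqVneq u e.
  exists 1%:M; first by rewrite /orthogonal_mx trmx1 mulmx1.
  by rewrite !mulmx1 ue.
pose z := u - e; have z0 : rvdot z z != 0.
  by apply/eqP => zz; move/eqP: ue; apply; apply/eqP; rewrite -subr_eq0;
    apply/eqP/(@dot_le0_eq0 _ _ rvdot); rewrite -/z /= zz.
have zzE : rvdot z z = 2 - 2 * rvdot u e.
  by rewrite (dotBB rvdot) /= u1 e1; ring.
pose c := 2 / rvdot z z; pose H : 'M[R]_n.+1 := 1%:M - c *: (z^T *m z).
have vH (v : 'rV_n.+1) : v *m H = v - (c * rvdot v z) *: z.
  rewrite mulmxBr mulmx1 -scalemxAr mulmxA dotE mul_scalar_mx scalerA.
  by [].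
have zc : c * rvdot z z = 2 by rewrite /c divfK.
have Ht : H^T = H by rewrite linearB /= linearZ /= trmx_mul trmxK trmx1.
have eH : e *m H = u.
  have -> : u = e + z by rewrite addrC subrK.
  rewrite vH; have -> : c * rvdot e z = - 1.
    apply: (mulIf z0); rewrite mulrAC zc zzE.
    by rewrite (linearBr rvdot) /= e1 (dotC rvdot e u) /=; ring.
  by rewrite scaleN1r opprK.
have uH : u *m H = e.
  have -> : e = u - z by rewrite opprB addrC subrK.
  rewrite vH; have -> : c * rvdot u z = 1.
    apply: (mulIf z0); rewrite mulrAC zc zzE.
    by rewrite (linearBr rvdot) /= u1; ring.
  by rewrite scale1r.
exists H; last by [].
split=> //; rewrite /orthogonal_mx Ht; apply/row_matrixP => i.
rewrite !rowE !mulmxA mulmx1 !vH (linearBl rvdot) /= (linearZl_LR rvdot) /=.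
rewrite -addrA -opprD -scalerDl mulrBr mulrCA zc.
suff -> : c * rvdot (delta_mx 0 i) z +
   (c * rvdot (delta_mx 0 i) z - c * rvdot (delta_mx 0 i) z * 2) = 0.
  by rewrite scale0r subr0.
by ring.
Qed.

(** Induction on the dimension: a reflection moves a unit eigenvector to the
first basis vector, and symmetry then splits off a block of size one. *)
Theorem spectral_theorem n (A : 'M[R]_n) : A^T = A ->
  exists2 P, orthogonal_mx P & exists d, A = conj_diag P d.
Proof.
elim: n A => [|n IHn] A At.
  exists 1%:M; first by rewrite /orthogonal_mx trmx1 mulmx1.
  by exists 0; apply/matrixP => -[].
have [l [_ lA]] : exists l, is_eigvals A l.
  by apply: is_eigvals_exists; rewrite symmetricmxE At.
have /eigenvalueP[v vA v0] : eigenvalue A (l 0 ord0).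
  rewrite eigenvalue_root_char lA /root horner_prod big_ord_recl.
  by rewrite hornerXsubC subrr mul0r.
set a := l 0 ord0 in vA.
have vv : 0 < dnorm rvdot v.
  by rewrite sqrtr_gt0; exact: (dot_gt0 rvdot v0).
pose u := (dnorm rvdot v)^-1 *: v.
have u1 : rvdot u u = 1.
  rewrite (linearZl_LR rvdot) (linearZr_LR rvdot) /= /GRing.scale /=.
  by rewrite -(sqr_dnorm rvdot) expr2 mulKf ?mulVf ?gt_eqF.
have uA : u *m A = a *: u by rewrite -scalemxAl vA !scalerA mulrC.
have [H [Ht HO] [eH uH]] := householder_reflection u1.
pose B : 'M[R]_(1 + n) := H *m A *m H.
have Bt : B^T = B by rewrite !trmx_mul At Ht mulmxA.
have rowB : row 0 B = a *: delta_mx 0 0.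
  by rewrite rowE !mulmxA eH uA -scalemxAl uH.
have AE : A = H *m B *m H.
  have HH : H *m H = 1%:M by rewrite -{1}Ht.
  by rewrite /B !mulmxA HH mul1mx -mulmxA HH mulmx1.
have {}rowB j : B 0 j = a * (j == 0)%:R.
  by move/rowP: rowB => /(_ j); rewrite [LHS]mxE [RHS]mxE [X in _ * X]mxE eqxx.
clearbody B.
have l0 : lshift n (0 : 'I_1) = 0 :> 'I_(1 + n) by exact: val_inj.
have B0 : B = block_mx a%:M 0 0 (drsubmx B).
  have ur : ursubmx B = 0.
    apply/matrixP => i j; rewrite !ord1 !mxE.
    by rewrite l0 rowB mulr0.
  rewrite -[LHS]submxK ur; congr block_mx; last first.
    by rewrite -[RHS]trmx0 -ur trmx_ursub Bt.
  apply/matrixP => i j; rewrite !ord1 !mxE eqxx mulr1n.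
  by rewrite l0 rowB mulr1.
have [P PO [d dP]] : exists2 P, orthogonal_mx P &
    exists d, drsubmx B = conj_diag P d.
  by apply: IHn; rewrite trmx_drsub Bt.
pose Q : 'M[R]_(1 + n) := block_mx 1%:M 0 0 P.
have QO : orthogonal_mx Q.
  rewrite /orthogonal_mx /Q tr_block_mx mulmx_block !trmx0 trmx1.
  by rewrite !mulmx0 !mul0mx !mulmx1 !addr0 !add0r PO -scalar_mx_block.
have key : B = Q *m diag_mx (row_mx a%:M d : 'rV_(1 + n)) *m Q^T.
  rewrite diag_mx_row tr_block_mx !mulmx_block !trmx0 trmx1 B0 dP /conj_diag.
  rewrite !mulmx0 !mul0mx !mulmx1 !mul1mx !addr0 !add0r.
  congr block_mx; last by rewrite mul0mx.
  by apply/matrixP => i j; rewrite !ord1 !mxE eqxx mulr1n.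
exists (H *m Q); first exact: orthogonal_mulmx.
exists (row_mx a%:M d).
by rewrite AE key /conj_diag trmx_mul Ht !mulmxA.
Qed.

End Spectral.

(** * Diagonalization with sorted eigenvalues *)

Section SymDiag.
Context {R : realType} {n : nat}.
Implicit Types (P : 'M[R]_n) (x y : 'rV[R]_n) (X Y : symmx R n).

Fact conj_diag_symmetricmx P x : conj_diag P x \is symmetricmx.
Proof. by rewrite symmetricmxE conj_diag_sym. Qed.

Definition sym_diag P x : symmx R n := SymMx (conj_diag_symmetricmx P x).

Lemma sym_diagB P x y : sym_diag P (x - y) = sym_diag P x - sym_diag P y.
Proof. by apply/val_inj; rewrite [RHS]raddfB /= conj_diagB. Qed.

Lemma symdot_sym_diag P x y : orthogonal_mx P ->
  symdot (sym_diag P x) (sym_diag P y) = rvdot x y.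
Proof.
move=> PO; rewrite /symdot /= /conj_diag -!mulmxA (mulmxA P^T P) PO mul1mx.
rewrite mxtrace_mulC -!mulmxA PO mulmx1 /mxtrace /rvdot.
by apply: eq_bigr => i _; rewrite mul_diag_mx !mxE eqxx mulr1n.
Qed.

Lemma dnorm_symdot X : dnorm symdot X = frob (val X).
Proof.
apply/eqP; rewrite -(@eqrXn2 _ 2) ?frob_ge0 ?dnorm_nneg//.
rewrite sqr_dnorm sqr_frob_tr /=.
by have /eqP -> : (val X)^T == val X by rewrite -symmetricmxE; exact: symmxP.
Qed.

(** The two vectors give the same factorization of the characteristic
polynomial. *)
Lemma eigvals_sym_diag_perm P x : orthogonal_mx P ->
  exists s : 'S_n, forall i, eigvals (sym_diag P x) 0 i = x 0 (s i).
Proof.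
move=> PO; have [_] := eigvalsP (sym_diag P x).
set l := eigvals _.
rewrite /= char_poly_conj_diag// => xl.
pose tl := [tuple l 0 i | i < n]; pose tx := [tuple x 0 i | i < n].
have /tuple_permP[s sE] : perm_eq tl tx.
  apply: prod_XsubC_eq; rewrite !big_map -enumT !big_enum /=; exact/esym.
exists s => i; have : tl = [tuple tnth tx (s i) | i < n] by exact: val_inj.
move=> /(congr1 (fun t => tnth t i)).
by rewrite !tnth_mktuple.
Qed.

Lemma eigvals_sorted X : nonincreasing_rv (eigvals X).
Proof. by have [] := eigvalsP X. Qed.

(** Reordering the columns of the frame sorts the diagonal. *)
Lemma eigvals_spectral X :
  exists2 P, orthogonal_mx P & X = sym_diag P (eigvals X).
Proof.
have [|P PO [d dP]] := @spectral_theorem _ _ (val X).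
  by apply/eqP; rewrite -symmetricmxE; exact: symmxP.
have XE : X = sym_diag P d by exact: val_inj.
have [s sE] := eigvals_sym_diag_perm d PO; rewrite -XE in sE.
exists (col_perm s P).
  rewrite /orthogonal_mx col_permE trmx_mul mulmxA -(mulmxA _ P^T) PO mulmx1.
  by rewrite tr_perm_mx -perm_mxM mulVg perm_mx1.
apply/val_inj/matrixP => i j; rewrite [in LHS]XE /= !conj_diagE.
rewrite (reindex_inj (@perm_inj _ s)); apply: eq_bigr => k _.
by rewrite !mxE sE.
Qed.

Lemma eigvals_sym_diag P x : orthogonal_mx P -> nonincreasing_rv x ->
  eigvals (sym_diag P x) = x.
Proof.
move=> PO xs; apply: (is_eigvals_unique (eigvalsP _)).
by split=> //; exact: char_poly_conj_diag.
Qed.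

Lemma symdot_eigvals X : symdot X X = rvdot (eigvals X) (eigvals X).
Proof.
have [P PO XE] := eigvals_spectral X.
by rewrite -(symdot_sym_diag _ _ PO) -XE.
Qed.

End SymDiag.

(** * Fan's trace inequality *)

Section Fan.
Context {R : realType}.

(** Summation by parts: every partial sum of [c] is multiplied by a nonnegative
decrement of [x], except the total sum, which is multiplied by the last entry
of [x]. *)
Lemma abel_ge n (c x : 'I_n.+1 -> R) :
  (forall i j : 'I_n.+1, (i <= j)%N -> x j <= x i) ->
  (forall k : nat, 0 <= \sum_(i < n.+1 | (i < k)%N) c i) ->
  x ord_max * \sum_i c i <= \sum_i c i * x i.
Proof.
elim: n c x => [|n IHn] c x xs cs.
  by rewrite !big_ord1 (ord1 ord_max) mulrC.
pose w := widen_ord (leqnSn n.+1).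
have cw k : (k <= n.+1)%N ->
    \sum_(i < n.+2 | (i < k)%N) c i = \sum_(i < n.+1 | (i < k)%N) c (w i).
  by move=> kn; rewrite big_mkcond big_ord_recr /= ltnNge kn addr0 -big_mkcond.
have /IHn : forall i j : 'I_n.+1, (i <= j)%N -> x (w j) <= x (w i).
  by move=> i j ij; apply: xs.
move=> /(_ (c \o w)) /= IH.
rewrite big_ord_recr [leRHS]big_ord_recr /= mulrDr (mulrC (c ord_max)) lerD2r.
apply: le_trans (IH _) => [|k].
  apply: ler_wpM2r; last by apply: xs; exact: leq_ord.
  have := cs n.+1; rewrite cw//; congr (_ <= _).
  by apply: eq_bigl => i; exact: ltn_ord.
have [kn|kn] := leqP k n.+1; first by rewrite -cw.
have := cs n.+1; rewrite cw// => /le_trans; apply; rewrite le_eqVlt.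
apply/orP; left; apply/eqP; apply: eq_bigl => i.
by rewrite ltn_ord (ltn_trans (ltn_ord i)).
Qed.

Lemma abel_sum_ge0 n (c : 'I_n -> R) (x : 'rV[R]_n) : nonincreasing_rv x ->
  \sum_i c i = 0 -> (forall k : nat, 0 <= \sum_(i < n | (i < k)%N) c i) ->
  0 <= \sum_i c i * x 0 i.
Proof.
case: n c x => [|n] c x xs c0 cs; first by rewrite big_ord0.
by apply: le_trans (abel_ge xs cs); rewrite c0 mulr0.
Qed.

(** Two summations by parts, one for [x] and one for [y], reduce the claim to
indicator vectors of initial segments: the entries of a doubly stochastic matrix
in its upper left k by l corner add up to at most the minimum of k and l. *)
Lemma doubly_stochastic_rearrangement n (D : 'M[R]_n) (x y : 'rV[R]_n) :
  nonincreasing_rv x -> nonincreasing_rv y ->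
  (forall i j, 0 <= D i j) ->
  (forall i, \sum_j D i j = 1) -> (forall j, \sum_i D i j = 1) ->
  \sum_i \sum_j D i j * x 0 i * y 0 j <= rvdot x y.
Proof.
move=> xs ys D0 Dr Dc.
rewrite -subr_ge0 [X in 0 <= X](_ : _ =
    \sum_i (y 0 i - \sum_j D i j * y 0 j) * x 0 i); last first.
  rewrite /rvdot -sumrB; apply: eq_bigr => i _.
  rewrite mulrBl mulr_suml [x 0 i * _]mulrC; congr (_ - _).
  by apply: eq_bigr => j _; ring.
apply: abel_sum_ge0 => //.
  rewrite sumrB exchange_big /= -sumrB big1// => j _.
  by rewrite -mulr_suml Dc mul1r subrr.
move=> k; rewrite [X in 0 <= X](_ : _ =
    \sum_(j < n) ((j < k)%N%:R - \sum_(i < n | (i < k)%N) D i j) * y 0 j);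
    last first.
  rewrite sumrB exchange_big /= big_mkcond /= -sumrB; apply: eq_bigr => j _.
  by rewrite mulrBl mulr_suml; case: ifP; rewrite ?mul1r ?mul0r.
apply: abel_sum_ge0 => //.
  rewrite sumrB exchange_big /= [X in _ - X](eq_bigr (fun=> 1))//.
  rewrite [X in _ - X]big_mkcond /= -sumrB big1// => i _.
  by case: ifP; rewrite subrr.
move=> l; rewrite sumrB subr_ge0.
have [kl|lk] := leqP k l.
  rewrite exchange_big /=; apply: (@le_trans _ _ (\sum_(i < n | (i < k)%N) 1)).
    apply: ler_sum => i _; rewrite -(Dr i).
    rewrite [leRHS](bigID (fun j : 'I_n => (j < l)%N)) /=.
    by rewrite lerDl sumr_ge0.
  rewrite big_mkcond [leRHS]big_mkcond /=; apply: ler_sum => i _.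
  by case: ifP => ik; case: ifP => //; rewrite (leq_trans ik).
apply: ler_sum => j jl; rewrite (ltn_trans jl lk) -(Dc j).
rewrite [leRHS](bigID (fun i : 'I_n => (i < k)%N)) /=.
by rewrite lerDl sumr_ge0.
Qed.

(** The squared entries of an orthogonal matrix form a doubly stochastic
matrix. *)
Lemma trace_orthogonal_le n (O : 'M[R]_n) (x y : 'rV[R]_n) :
  orthogonal_mx O -> nonincreasing_rv x -> nonincreasing_rv y ->
  \tr ((diag_mx x *m O) *m (diag_mx y *m O^T)) <= rvdot x y.
Proof.
move=> OO xs ys; pose D := map_mx (fun a => a ^+ 2) O.
have -> : \tr ((diag_mx x *m O) *m (diag_mx y *m O^T)) =
    \sum_i \sum_j D i j * x 0 i * y 0 j.
  apply: eq_bigr => i _; rewrite mxE; apply: eq_bigr => j _.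
  by rewrite !mul_diag_mx !mxE; ring.
apply: doubly_stochastic_rearrangement => //.
- by move=> i j; rewrite mxE sqr_ge0.
- move=> i; have /matrixP/(_ i i) := orthogonal_mxC OO.
  rewrite !mxE eqxx mulr1n => <-; apply: eq_bigr => j _.
  by rewrite !mxE expr2.
- move=> j; have /matrixP/(_ j j) := OO.
  rewrite !mxE eqxx mulr1n => <-; apply: eq_bigr => i _.
  by rewrite !mxE expr2.
Qed.

Theorem fan_inequality n (X Y : symmx R n) :
  symdot X Y <= rvdot (eigvals X) (eigvals Y).
Proof.
have [P PO XE] := eigvals_spectral X; have [Q QO YE] := eigvals_spectral Y.
have OO : orthogonal_mx (P^T *m Q).
  by apply: orthogonal_mulmx => //; exact: orthogonal_trmx.
apply: le_trans (trace_orthogonal_le OO (eigvals_sorted X) (eigvals_sorted Y)).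
rewrite {1}/symdot {1}XE {1}YE /= /conj_diag -!mulmxA mxtrace_mulC -!mulmxA.
by rewrite trmx_mul trmxK !mulmxA.
Qed.

(** Diagonalize the sum Z = X + Y in a frame P, with sorted eigenvalues z.
Equality gives |Z| = |x + y|, and Fan's inequality for (Z, X) and (Z, Y) gives
|Z|^2 <= <z, x + y>; so z = x + y, and both of these are equalities.  Now
z - x = y is sorted too, so Fan's inequality applies to P diag(z - x) P^T and X.
Subtracted from <Z, X> = <z, x>, it bounds the inner product of P diag(x) P^T
and X below by |x|^2, the product of their norms, so these matrices are
equal. *)
Theorem fan_equality n (X Y : symmx R n) :
  symdot X Y = rvdot (eigvals X) (eigvals Y) ->
  exists P, [/\ orthogonal_mx P, X = sym_diag P (eigvals X) &
    Y = sym_diag P (eigvals Y)].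
Proof.
set x := eigvals X; set y := eigvals Y => XY.
have [P PO] := eigvals_spectral (X + Y); set z := eigvals (X + Y) => ZE.
have zx : symdot (X + Y) X <= rvdot z x by exact: fan_inequality.
have zy : symdot (X + Y) Y <= rvdot z y by exact: fan_inequality.
have XYE : symdot (X + Y) (X + Y) = symdot (X + Y) X + symdot (X + Y) Y.
  by rewrite [LHS]linearDr.
have zzE : symdot (X + Y) (X + Y) = rvdot z z by exact: symdot_eigvals.
have xyE : symdot (X + Y) (X + Y) = rvdot (x + y) (x + y).
  rewrite (dotDD symdot) (dotDD rvdot) /= XY.
  by rewrite (symdot_eigvals X) (symdot_eigvals Y).
have zE : z = x + y.
  apply/eqP; rewrite -subr_eq0; apply/eqP/(dot_le0_eq0 (dot := rvdot)).
  rewrite (dotBB rvdot) /= -zzE -xyE (linearDr rvdot) /=.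
  move: (lerD zx zy); rewrite -XYE.
  by move: (symdot _ _) (rvdot z x) (rvdot z y); clear; move=> *; lra.
have {}zx : symdot (X + Y) X = rvdot z x.
  apply/eqP; rewrite eq_le zx /=.
  have : rvdot z z = rvdot z x + rvdot z y by rewrite {2}zE [LHS]linearDr.
  move: zy; rewrite -zzE XYE.
  move: (symdot _ X) (symdot _ Y) (rvdot z x) (rvdot z y).
  by clear; move=> *; lra.
have yE : sym_diag P y = (X + Y) - sym_diag P x.
  by rewrite ZE -sym_diagB zE addrAC subrr add0r.
have XE : X = sym_diag P x.
  apply/eqP; rewrite -subr_eq0; apply/eqP/(dot_le0_eq0 (dot := symdot)).
  rewrite (dotBB symdot) /= symdot_sym_diag// symdot_eigvals -/x.
  have := fan_inequality (sym_diag P y) X.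
  rewrite eigvals_sym_diag//; last exact: eigvals_sorted.
  rewrite yE (linearBl symdot) /= zx zE (linearDl rvdot) /=.
  rewrite (dotC symdot (sym_diag P x)) /= -/x.
  by move: (symdot _ _) (rvdot x x) (rvdot y x); clear; move=> *; lra.
exists P; split; [exact: PO|exact: XE|].
by rewrite yE -XE addrAC subrr add0r.
Qed.

End Fan.

(** * Subgradients of spectral functions *)

Section Subdifferential.
Context {R : realType} {n : nat}.
Implicit Types (P : 'M[R]_n) (x y w : 'rV[R]_n) (X Y W : symmx R n).

(** X and its eigenvalue vector have the same norm, so this is Fan's inequality
after expanding the squares. *)
Lemma eigvals_nonexpansive X Y :
  dnorm rvdot (eigvals X - eigvals Y) <= dnorm symdot (X - Y).
Proof.
rewrite -(@ler_pXn2r _ 2) ?nnegrE ?dnorm_nneg// !sqr_dnorm.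
rewrite (dotBB rvdot) (dotBB symdot) /= (symdot_eigvals X) (symdot_eigvals Y).
by rewrite lerD2r lerD2l lerN2 ler_pM2l// fan_inequality.
Qed.

Variable g : 'rV[R]_n -> \bar R.
Hypothesis g_perm : perm_invariant g.

Lemma spectral_fun_sym_diag P x : orthogonal_mx P ->
  spectral_fun g (sym_diag P x) = g x.
Proof.
move=> PO; have [s sE] := eigvals_sym_diag_perm x PO.
rewrite /spectral_fun; have -> : eigvals (sym_diag P x) = x *m perm_mx s^-1.
  by apply/rowP => i; rewrite -col_permE mxE sE.
by rewrite -g_perm// perm_mx_is_perm.
Qed.

(** Fan's inequality for P diag(w) P^T, with [w] sorted, and an arbitrary Y; the
value of the spectral function at P diag(x) P^T is g(x) whatever the order of
[x], by permutation invariance. *)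
Lemma subdiff_sym_diag P x w : orthogonal_mx P -> nonincreasing_rv w ->
  subdiff rvdot g x w ->
  subdiff symdot (spectral_fun g) (sym_diag P x) (sym_diag P w).
Proof.
move=> PO ws xw Y; rewrite spectral_fun_sym_diag//.
apply: le_trans (xw (eigvals Y)); apply: leeD2l; rewrite lee_fin.
rewrite (linearBr rvdot) (linearBr symdot) /= symdot_sym_diag// lerD2r.
by have := fan_inequality (sym_diag P w) Y; rewrite eigvals_sym_diag.
Qed.

Hypothesis g_proper : proper_fun g.

(** Test the subgradient inequality at the matrix that has the eigenvalues of
[X] in the eigenvectors of [W]: the function takes the same, finite, value
there as at [X]. *)
Lemma subdiff_spectral_fan_eq X W : subdiff symdot (spectral_fun g) X W ->
  symdot X W = rvdot (eigvals X) (eigvals W).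
Proof.
move=> XW; apply/eqP; rewrite eq_le fan_inequality /=.
have [Q QO WE] := eigvals_spectral W.
have gx : g (eigvals X) \is a fin_num.
  rewrite fin_numE g_proper.1 /=; apply/eqP => gxoo.
  have [y] := g_proper.2; have := XW (sym_diag 1%:M y).
  rewrite spectral_fun_sym_diag; last by rewrite /orthogonal_mx trmx1 mulmx1.
  by rewrite {1}/spectral_fun gxoo addye// leye_eq => ->.
have := XW (sym_diag Q (eigvals X)); rewrite spectral_fun_sym_diag//.
rewrite /spectral_fun -leeBrDl// subee// lee_fin (linearBr symdot) /=.
rewrite {1}WE symdot_sym_diag// subr_le0.
by rewrite (dotC symdot) /= (dotC rvdot).
Qed.

Lemma subdiff_eigvals X W : subdiff symdot (spectral_fun g) X W ->
  subdiff rvdot g (eigvals X) (eigvals W).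
Proof.
move=> XW y; have [Q QO WE] := eigvals_spectral W.
have := XW (sym_diag Q y); rewrite spectral_fun_sym_diag//.
rewrite (linearBr symdot) (linearBr rvdot) /= (dotC symdot W X) /=.
have -> : symdot W (sym_diag Q y) = rvdot (eigvals W) y.
  by rewrite {1}WE symdot_sym_diag.
by rewrite (subdiff_spectral_fan_eq XW) (dotC rvdot (eigvals X) (eigvals W)).
Qed.

End Subdifferential.

(** * Perturbation of eigenbases *)

Section Perturbation.
Context {R : realType} {n : nat}.

Lemma eigvals_gap (w : 'rV[R]_n) : exists2 gap : R, 0 < gap &
  forall i j, w 0 i != w 0 j -> gap <= `|w 0 i - w 0 j|.
Proof.
(* The minimum is over no pairs at all when the entries are equal, whence the
   positive base value. *)
exists (\big[Order.min/1]_(p : 'I_n * 'I_n | w 0 p.1 != w 0 p.2)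
    `|w 0 p.1 - w 0 p.2|).
  elim/big_ind: _ => // [a b a0 b0|[i j] /= ij].
    by rewrite lt_min a0.
  by rewrite normr_gt0 subr_eq0.
by move=> i j ij; apply: (bigmin_le_cond _ (j := (i, j))).
Qed.

(** [U] is the orthogonal polar factor B (B^T B)^(-1/2).  It commutes with [D]
because B^T B does, and B - U = U ((B^T B)^(1/2) - 1) is estimated through
|sqrt s - 1| <= |s - 1|.  The bound 1/2 only keeps the eigenvalues of B^T B
positive. *)
Lemma polar_factor_comm (B D : 'M[R]_n) :
  D *m B = B *m D -> D^T = D -> frob (B^T *m B - 1%:M) <= 2^-1 ->
  exists U, [/\ orthogonal_mx U, D *m U = U *m D &
    frob (B - U) <= frob (B^T *m B - 1%:M)].
Proof.
move=> DB Dt; set S := B^T *m B => Sle.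
have DBt : D *m B^T = B^T *m D by rewrite -{1}Dt -trmx_mul -DB trmx_mul Dt.
have DS : D *m S = S *m D by rewrite /S mulmxA DBt -mulmxA DB mulmxA.
have [|V VO [s SE]] := @spectral_theorem R n S.
  by rewrite /S trmx_mul trmxK.
have S1E : S - 1%:M = conj_diag V (s - const_mx 1).
  by rewrite conj_diagB conj_diag1// -SE.
have s_gt0 i : 0 < s 0 i.
  have := abs_le_dnorm (s - const_mx 1) i.
  rewrite -(frob_conj_diag _ VO) -S1E => /le_trans/(_ Sle).
  rewrite !mxE ler_norml => /andP[+ _].
  by move: (s 0 i) => a; clear; move=> ?; lra.
pose F := conj_diag V (map_mx (fun a => (Num.sqrt a)^-1) s).
pose G := conj_diag V (map_mx Num.sqrt s).
have sq0 i : Num.sqrt (s 0 i) != 0 by rewrite gt_eqF// sqrtr_gt0.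
have FG : F *m G = 1%:M.
  rewrite conj_diagM// -(conj_diag1 VO); congr conj_diag.
  by apply/rowP => i; rewrite !mxE mulVf.
have FSF : F *m S *m F = 1%:M.
  rewrite SE conj_diagM// conj_diagM// -(conj_diag1 VO); congr conj_diag.
  apply/rowP => i; rewrite !mxE -{2}(sqr_sqrtr (ltW (s_gt0 i))).
  by rewrite expr2 mulKf// mulfV.
have DF : D *m F = F *m D.
  by apply: comm_conj_diag_map => //; rewrite -SE.
pose U := B *m F; have UO : orthogonal_mx U.
  by rewrite /orthogonal_mx trmx_mul conj_diag_sym -/F mulmxA -(mulmxA F) FSF.
exists U; split=> //.
  by rewrite /U mulmxA DB -mulmxA DF mulmxA.
have -> : B - U = U *m (G - 1%:M).
  by rewrite mulmxBr mulmx1 /U -(mulmxA B) FG mulmx1.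
rewrite frob_orthoL// S1E -[X in _ - X](conj_diag1 VO) -conj_diagB.
rewrite !frob_conj_diag//; apply: le_dnorm => i; rewrite !mxE.
rewrite -{2}(sqr_sqrtr (ltW (s_gt0 i))) -[X in _ <= `|_ - X|](expr1n _ 2).
rewrite subr_sqr normrM ler_peMr// ger0_norm ?addr_ge0// ?sqrtr_ge0//.
by rewrite lerDr sqrtr_ge0.
Qed.

(** An eigenbasis [P] of [W] can be moved to an eigenbasis [Q] of [W0] at a cost
proportional to |W - W0|, although [W0] may have multiple eigenvalues: only the
entries of [P] that mix distinct eigenvalues of [W0] are controlled by the gap,
and within each eigenspace of [W0] the basis [Q] follows [P]. *)
Lemma eigenbasis_perturbation (W0 W : symmx R n) (gap : R) (P : 'M[R]_n) :
  0 < gap ->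
  (forall i j, eigvals W0 0 i != eigvals W0 0 j ->
     gap <= `|eigvals W0 0 i - eigvals W0 0 j|) ->
  8 * n.+1%:R * dnorm symdot (W - W0) <= gap ->
  orthogonal_mx P -> W = sym_diag P (eigvals W) ->
  exists Q, [/\ orthogonal_mx Q, W0 = sym_diag Q (eigvals W0) &
    frob (P - Q) <=
      (1 + 2 * n.+1%:R) * (2 / gap) * dnorm symdot (W - W0)].
Proof.
move=> gap0 gapP Wgap PO WE.
have [Q0 Q0O W0E] := eigvals_spectral W0.
have ww0 i : `|eigvals W 0 i - eigvals W0 0 i| <= dnorm symdot (W - W0).
  apply: le_trans (eigvals_nonexpansive W W0).
  by apply: le_trans (abs_le_dnorm _ i); rewrite !mxE.
set w := eigvals W in WE ww0 *; set w0 := eigvals W0 in W0E gapP ww0 *.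
pose O := Q0^T *m P.
have OE : P = Q0 *m O by rewrite mulmxA (orthogonal_mxC Q0O) mul1mx.
have OO : orthogonal_mx O.
  by apply: orthogonal_mulmx => //; exact: orthogonal_trmx.
(* The entry (i, j) of [E] is O_ij (w_j - w0_i). *)
pose E := O *m diag_mx w - diag_mx w0 *m O.
have EE : frob E = dnorm symdot (W - W0).
  rewrite dnorm_symdot raddfB /= {1}WE {1}W0E /=.
  by rewrite frob_conj_diag_sub_frame.
set r := dnorm symdot (W - W0) in Wgap ww0 EE *.
clearbody O w w0 r.
have N1 : 1 <= n.+1%:R :> R by rewrite ler1n.
have r0 : 0 <= r by rewrite -EE frob_ge0.
have frobO : frob O <= n.+1%:R.
  by rewrite -(mulmx1 O) frob_orthoL// frob1.
pose B := \matrix_(i, j) if w0 0 i == w0 0 j then O i j else 0.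
have frobB : frob B <= n.+1%:R.
  apply: le_trans frobO; rewrite -[leRHS]mul1r; apply: le_frob => // i j.
  by rewrite mxE mul1r; case: ifP => //; rewrite normr0.
have OB : frob (O - B) <= 2 / gap * r.
  rewrite -EE; apply: le_frob; first by rewrite divr_ge0// ltW.
  move=> i j; rewrite /E mul_mx_diag mul_diag_mx !mxE.
  case: ifPn => [_|ij]; first by rewrite subrr normr0 mulr_ge0// divr_ge0// ltW.
  rewrite subr0 [w0 0 i * _]mulrC -mulrBr normrM mulrCA ler_peMr//.
  rewrite mulrAC ler_pdivlMr// mul1r.
  have := gapP _ _ ij; have := ww0 j.
  have := ler_distD (w 0 j) (w0 0 i) (w0 0 j).
  rewrite (distrC (w0 0 i) (w 0 j)).
  (* |w_j - w0_j| <= gap / 8 leaves at least half of the gap to |w_j - w0_i|. *)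
  have : 8 * r <= gap.
    apply: le_trans Wgap; rewrite ler_wpM2r// ler_peMr//.
  move: gap0 r0; move: `|_| `|_| `|_|; clear; move=> *; lra.
have BtB : frob (B^T *m B - 1%:M) <= 2 * n.+1%:R * (2 / gap * r).
  have -> : B^T *m B - 1%:M = B^T *m (B - O) + (B - O)^T *m O.
    rewrite -OO mulmxBr [(B - O)^T]linearB /= mulmxBl.
    by rewrite addrA subrK.
  apply: le_trans (frobD _ _) _.
  apply: le_trans (lerD (frobM _ _) (frobM _ _)) _.
  rewrite !frob_tr -(frobN (B - O)) opprB [X in _ + X]mulrC -mulrDl.
  apply: ler_pM => //; rewrite ?addr_ge0 ?frob_ge0//.
  by rewrite mulr_natl mulr2n lerD.
have [|||U [UO UD UB]] := @polar_factor_comm B (diag_mx w0).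
- apply/matrixP => i j; rewrite mul_mx_diag mul_diag_mx !mxE.
  by case: eqP => [->|_]; rewrite ?mulr0 ?mul0r// mulrC.
- exact: tr_diag_mx.
- apply: le_trans BtB _.
  rewrite (_ : _ * _ = (8 * n.+1%:R * r) * (2^-1 / gap)); last first.
    by field; rewrite gt_eqF.
  rewrite mulrA ler_pdivrMr// mulrC ler_wpM2l// invr_ge0//.
pose Q := Q0 *m U.
have QO : orthogonal_mx Q by exact: orthogonal_mulmx.
exists Q; split => //.
  rewrite W0E; apply: val_inj; rewrite /= /conj_diag /Q trmx_mul !mulmxA.
  by rewrite -(mulmxA Q0 U) -UD !mulmxA -(mulmxA _ U) orthogonal_mxC// mulmx1.
have -> : P - Q = Q0 *m (O - U).
  by rewrite mulmxBr -OE.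
rewrite frob_orthoL//.
have -> : O - U = (O - B) + (B - U) by rewrite addrA subrK.
apply: le_trans (frobD _ _) _; rewrite -mulrA mulrDl mul1r lerD//.
by apply: le_trans UB _; rewrite -mulrA in BtB *.
Qed.

End Perturbation.

(** * Metric subregularity of the spectral subdifferential *)

Theorem proposition15 (R : realType) (n : nat) (g : 'rV[R]_n -> \bar R)
    (Xbar Wbar : symmx R n) :
  proper_fun g -> lower_semicontinuous g -> econvex_fun g ->
  perm_invariant g ->
  gph (subdiff symdot (spectral_fun g)) (Xbar, Wbar) ->
  metrically_subregular rvdot rvdot (subdiff rvdot g)
    (eigvals Xbar) (eigvals Wbar) ->
  metrically_subregular symdot symdot (subdiff symdot (spectral_fun g))
    Xbar Wbar.
Proof.
move=> g_proper _ _ g_perm XW0 [_ [delta [eps [kappa [d0 e0 k0 sub]]]]].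
split=> //; have [gap gap0 gapP] := eigvals_gap (eigvals Wbar).
have N0 : 0 < 8 * n.+1%:R :> R by rewrite mulr_gt0.
pose K : R := (1 + 2 * n.+1%:R) * (2 / gap).
have K0 : 0 <= K by rewrite mulr_ge0 ?addr_ge0 ?divr_ge0// ltW.
pose L := 2 * K * (dnorm symdot Xbar + eps) + kappa.
have Xe0 : 0 <= dnorm symdot Xbar + eps by rewrite addr_ge0 ?dnorm_nneg// ltW.
have L0 : 0 < L by rewrite ltr_wpDl// mulr_ge0// mulr_ge0.
exists (Num.min delta (gap / (8 * n.+1%:R))), eps, L; split => //.
  by rewrite lt_min d0 divr_gt0.
move=> X XXbar; rewrite -lee_pdivrMl//; apply: le_ereal_inf_tmp.
move=> _ [W [XW WWbar] <-]; rewrite lee_pdivrMl// -EFinM.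
(* The infimum defining the distance from the eigenvalue vector [x] of [X] may
   not be attained, hence the slack [e]. *)
apply/lee_addgt0Pr => e epos; rewrite -EFinD.
rewrite dnorm_subC; set r := dnorm symdot (W - Wbar).
move: WWbar; rewrite /cball /= -/r le_min => /andP[rdelta].
rewrite ler_pdivlMr// mulrC => rgap.
have XW_tight := subdiff_spectral_fan_eq g_perm g_proper XW.
have [P [PO XE WE]] := fan_equality XW_tight.
have [Q [QO WbarE PQ]] := eigenbasis_perturbation gap0 gapP rgap PO WE.
rewrite -/K -/r in PQ.
set x := eigvals X in XE *.
have xball : cball rvdot (eigvals Xbar) eps x.
  exact: le_trans (eigvals_nonexpansive _ _) XXbar.
have wdist : dnorm rvdot (eigvals Wbar - eigvals W) <= r.
  by rewrite dnorm_subC; exact: eigvals_nonexpansive.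
have /ereal_inf_lt[_ [x' x'W <-]] :
    (dist_set rvdot x (inv_map (subdiff rvdot g) (eigvals Wbar)) <
     (kappa * r + e)%:E)%E.
  apply: le_lt_trans (sub x xball) _.
  apply: (@le_lt_trans _ _ (kappa * r)%:E); last by rewrite lte_fin ltrDl.
  rewrite EFinM lee_pmul2l//.
  apply: (@le_trans _ _ (dnorm rvdot (eigvals Wbar - eigvals W))%:E);
    last by rewrite lee_fin.
  apply: ereal_inf_lbound; exists (eigvals W) => //; split.
    exact: subdiff_eigvals.
  by rewrite /cball /= dnorm_subC; exact: le_trans wdist rdelta.
rewrite lte_fin => xx'.
apply: (@le_trans _ _ (dnorm symdot (X - sym_diag Q x'))%:E).
  apply: ereal_inf_lbound; exists (sym_diag Q x') => //.
  rewrite /inv_map /= WbarE; apply: subdiff_sym_diag => //.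
  exact: eigvals_sorted.
rewrite lee_fin.
have -> : X - sym_diag Q x' = (X - sym_diag Q x) + sym_diag Q (x - x').
  by rewrite sym_diagB addrA subrK.
apply: le_trans (dnorm_triangle symdot _ _) _.
have xle : dnorm rvdot x <= dnorm symdot Xbar + eps.
  have -> : dnorm rvdot x = dnorm symdot X by rewrite /dnorm /= symdot_eigvals.
  rewrite -[X](subrK Xbar) addrC; apply: le_trans (dnorm_triangle symdot _ _) _.
  by rewrite lerD2l.
have XQ : dnorm symdot (X - sym_diag Q x) <=
    2 * K * (dnorm symdot Xbar + eps) * r.
  rewrite {1}XE dnorm_symdot raddfB /=.
  apply: le_trans (frob_conj_diag_sub _ PO QO) _.
  rewrite [leRHS]mulrAC.
  apply: ler_pM => //; rewrite ?mulr_ge0 ?frob_ge0 ?dnorm_nneg//.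
  by rewrite -mulrA ler_wpM2l.
rewrite /L mulrDl -addrA lerD// dnorm_symdot /= frob_conj_diag//.
exact: ltW.
Qed.
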